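(* Let $G^*$ be the cubic graph on $24$ vertices and $S_{10}$ the cubic graph on $10$ vertices defined in the context. Then $G^*$ cannot be colored by $S_{10}$, i.e. there is no $S_{10}$-coloring $f\colon E(G^* )\to E(S_{10})$ of $G^*$.
   Context: Graphs are finite and may have parallel edges but no loops. For a graph $G$ and $v\in V(G)$, $\partial_G(v)$ denotes the set of edges of $G$ incident with $v$. Two distinct edges are adjacent if they share at least one end vertex (so parallel edges are adjacent). A graph is cubic if every vertex is incident with exactly three edges. $H$-coloring: for graphs $G$ and $H$, an $H$-coloring of $G$ is a mapping $f\colon E(G)\to E(H)$ such that (1) if $e_1,e_2\in E(G)$ are adjacent, then $f(e_1)\neq f(e_2)$; (2) for every $v\in V(G)$ there exists a vertex $u\in V(H)$ with $f(\partial_G(v))=\partial_H(u)$. If such a mapping exists, one says that $H$ colors $G$ (written $H\prec G$). The graph $S_4$: it has vertices $x,y,z,w$; $x$ and $y$ are joined by two parallel edges, and the remaining edges are the single edges $xz$, $yz$, $zw$ (so $w$ has degree $1$ and $x,y,z$ have degree $3$). The graph $S_{10}$ (Sylvester graph): it has vertices $w$ and $x_i,y_i,z_i$ for $i=1,2,3$; for each $i\in\{1,2,3\}$, $x_i$ and $y_i$ are joined by two parallel edges, and there are single edges $x_iz_i$, $y_iz_i$, $z_iw$. There are no other edges. The graph $G^*$: take a copy of the Petersen graph $P$ and choose a vertex $u$ of it (the choice is irrelevant up to isomorphism); let $h_1,h_2,h_3$ be the neighbours of $u$ in $P$. Subdivide each of the three edges incident with $u$ by one new vertex, and expand one of the three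 new vertices to a triangle; then attach a copy of $S_4$ to each of the three resulting vertices of degree $2$, by identifying the degree-$1$ vertex of the copy of $S_4$ with that vertex. Explicitly: delete the edges $uh_1,uh_2,uh_3$ from $P$; add vertices $s_1,s_2,t_1,t_2,t_3$ and the edges $us_1$, $s_1h_1$, $us_2$, $s_2h_2$, $ut_1$, $t_1t_2$, $t_2t_3$, $t_1t_3$, $t_2h_3$; finally, for each $q\in\{s_1,s_2,t_3\}$ add three new vertices $x^q,y^q,z^q$, two parallel edges joining $x^q$ and $y^q$, and the single edges $x^qz^q$, $y^qz^q$, $z^qq$. *)

(* Defs.v *)
From HB Require Import structures.
From mathcomp Require Import all_boot.

Set Implicit Arguments.
Unset Strict Implicit.
Unset Printing Implicit Defensive.

(* Finite loopless multigraphs: parallel edges are distinct elements of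
   [edge G] with the same set of end vertices. *)
Record mgraph := MGraph {
  vert : finType;
  edge : finType;
  ends : edge -> {set vert};
  card_ends : forall e, #|ends e| = 2
}.

Definition incident_edges (G : mgraph) (v : vert G) : {set edge G} :=
  [set e | v \in ends e].

Definition adjacent (G : mgraph) (e1 e2 : edge G) : bool :=
  (e1 != e2) && [exists v, (v \in ends e1) && (v \in ends e2)].

Definition cubic (G : mgraph) : Prop :=
  forall v : vert G, #|incident_edges v| = 3.

Definition is_coloring (G H : mgraph) (f : edge G -> edge H) : Prop :=
  (forall e1 e2 : edge G, adjacent e1 e2 -> f e1 <> f e2) /\
  (forall v : vert G, exists u : vert H,
     f @: incident_edges v = incident_edges u).

(* [colors H G] is the relation usually written $H \prec G$: the edges of G
   receive edges of H as colors. *)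
Definition colors (H G : mgraph) : Prop :=
  exists f : edge G -> edge H, is_coloring f.

Definition loopless (V : eqType) (s : seq (V * V)) : bool :=
  all (fun p => p.1 != p.2) s.

Definition list_ends (V : finType) (s : seq (V * V)) (i : 'I_(size s)) :
    {set V} :=
  [set (tnth (in_tuple s) i).1; (tnth (in_tuple s) i).2].

Lemma card_list_ends (V : finType) (s : seq (V * V)) (s_ok : loopless s)
  (i : 'I_(size s)) : #|list_ends i| = 2.
Proof.
by rewrite /list_ends cards2 (allP s_ok) // (mem_tnth i (in_tuple s)).
Qed.

(* The edges are the positions in the list, so that a pair occurring twice
   yields two parallel edges. *)
Definition mgraph_of_list (V : finType) (s : seq (V * V))
    (s_ok : loopless s) : mgraph :=
  MGraph (card_list_ends s_ok).

Lemma card_incident_list (V : finType) (s : seq (V * V)) (s_ok : loopless s)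
    (v : V) :
  #|@incident_edges (mgraph_of_list s_ok) v|
  = count (fun p => (v == p.1) || (v == p.2)) s.
Proof.
have -> : count (fun p => (v == p.1) || (v == p.2)) s
    = count (fun p => (v == p.1) || (v == p.2))
        [seq tnth (in_tuple s) i | i <- enum 'I_(size s)].
  by rewrite map_tnth_enum.
rewrite count_map cardE -size_filter {1}/enum_mem -enumT; congr size.
by apply: (@eq_filter 'I_(size s)) => i; rewrite /= [LHS]in_set /= in_setU !in_set1.
Qed.

(* The edges of the copy of $S_4$ with vertices x, y, z, w, where w is the
   vertex of degree 1. *)
Definition S4_edges (V : Type) (x y z w : V) : seq (V * V) :=
  [:: (x, y); (x, y); (x, z); (y, z); (z, w)].

Inductive S10_vertex : Type :=
  | S10_w | S10_x1 | S10_y1 | S10_z1 | S10_x2 | S10_y2 | S10_z2 | S10_x3 |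
  S10_y3 | S10_z3.

Definition S10_vertices : seq S10_vertex :=
  [:: S10_w; S10_x1; S10_y1; S10_z1; S10_x2; S10_y2; S10_z2; S10_x3;
      S10_y3; S10_z3].

Definition S10_code (v : S10_vertex) : nat :=
  match v with
  | S10_w => 0 | S10_x1 => 1 | S10_y1 => 2 | S10_z1 => 3 | S10_x2 => 4
  | S10_y2 => 5 | S10_z2 => 6 | S10_x3 => 7 | S10_y3 => 8 | S10_z3 => 9
  end.

Definition S10_decode (i : nat) : S10_vertex :=
  nth S10_w S10_vertices i.

Lemma S10_codeK : cancel S10_code S10_decode.
Proof. by repeat case. Qed.

HB.instance Definition _ := Countable.copy S10_vertex (can_type S10_codeK).

Lemma S10_enumP : Finite.axiom S10_vertices.
Proof. by repeat case. Qed.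

HB.instance Definition _ := isFinite.Build S10_vertex S10_enumP.

Definition S10_edges : seq (S10_vertex * S10_vertex) :=
  S4_edges S10_x1 S10_y1 S10_z1 S10_w ++
  S4_edges S10_x2 S10_y2 S10_z2 S10_w ++
  S4_edges S10_x3 S10_y3 S10_z3 S10_w.

Lemma S10_loopless : loopless S10_edges.
Proof. by []. Qed.

Definition S10 : mgraph := mgraph_of_list S10_loopless.

Lemma card_S10 : #|vert S10| = 10.
Proof. by rewrite cardT enumT unlock. Qed.

Lemma S10_cubic : cubic S10.
Proof. by move=> v; rewrite card_incident_list; move: v; repeat case. Qed.

(* The Petersen graph as the Kneser graph K(5,2): the vertex Pij stands for
   the subset {i, j} of {1, ..., 5}; see [petersen_kneser]. *)
Inductive petersen_vertex : Type :=
  | P12 | P13 | P14 | P15 | P23 | P24 | P25 | P34 | P35 | P45.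

Definition petersen_vertices : seq petersen_vertex :=
  [:: P12; P13; P14; P15; P23; P24; P25; P34; P35; P45].

Definition petersen_code (v : petersen_vertex) : nat :=
  match v with
  | P12 => 0 | P13 => 1 | P14 => 2 | P15 => 3 | P23 => 4 | P24 => 5
  | P25 => 6 | P34 => 7 | P35 => 8 | P45 => 9
  end.

Definition petersen_decode (i : nat) : petersen_vertex :=
  nth P12 petersen_vertices i.

Lemma petersen_codeK : cancel petersen_code petersen_decode.
Proof. by repeat case. Qed.

HB.instance Definition _ := Countable.copy petersen_vertex (can_type petersen_codeK).

Lemma petersen_enumP : Finite.axiom petersen_vertices.
Proof. by repeat case. Qed.

HB.instance Definition _ := isFinite.Build petersen_vertex petersen_enumP.

Definition petersen_edges : seq (petersen_vertex * petersen_vertex) :=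
  [:: (P12, P34); (P12, P35); (P12, P45); (P13, P24); (P13, P25);
      (P13, P45); (P14, P23); (P14, P25); (P14, P35); (P15, P23);
      (P15, P24); (P15, P34); (P23, P45); (P24, P35); (P25, P34)].

Lemma petersen_loopless : loopless petersen_edges.
Proof. by []. Qed.

Definition petersen : mgraph := mgraph_of_list petersen_loopless.

Lemma card_petersen : #|vert petersen| = 10.
Proof. by rewrite cardT enumT unlock. Qed.

Lemma petersen_cubic : cubic petersen.
Proof. by move=> v; rewrite card_incident_list; move: v; repeat case. Qed.

Definition petersen_label (v : petersen_vertex) : nat * nat :=
  match v with
  | P12 => (1, 2) | P13 => (1, 3) | P14 => (1, 4) | P15 => (1, 5)
  | P23 => (2, 3) | P24 => (2, 4) | P25 => (2, 5) | P34 => (3, 4)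
  | P35 => (3, 5) | P45 => (4, 5)
  end.

Lemma petersen_kneser (v w : petersen_vertex) :
  count (fun e => (e == (v, w)) || (e == (w, v))) petersen_edges
  = ~~ has (fun i => i \in [:: (petersen_label v).1; (petersen_label v).2])
       [:: (petersen_label w).1; (petersen_label w).2].
Proof. by move: v w; do 2 case. Qed.

(* [Pet P12] is the vertex u of the Petersen graph, and h1, h2, h3 are its
   neighbours [Pet P34], [Pet P35], [Pet P45]. *)
Inductive Gstar_vertex : Type :=
  | Pet of petersen_vertex
  | s1 | s2 | t1 | t2 | t3 | x_s1 | y_s1 | z_s1 | x_s2 | y_s2 | z_s2 |
  x_t3 | y_t3 | z_t3.

Definition Gstar_vertices : seq Gstar_vertex :=
  [:: Pet P12; Pet P13; Pet P14; Pet P15; Pet P23; Pet P24; Pet P25;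
      Pet P34; Pet P35; Pet P45; s1; s2; t1; t2; t3; x_s1; y_s1; z_s1;
      x_s2; y_s2; z_s2; x_t3; y_t3; z_t3].

Definition Gstar_code (v : Gstar_vertex) : nat :=
  match v with
  | Pet P12 => 0 | Pet P13 => 1 | Pet P14 => 2 | Pet P15 => 3
  | Pet P23 => 4 | Pet P24 => 5 | Pet P25 => 6 | Pet P34 => 7
  | Pet P35 => 8 | Pet P45 => 9 | s1 => 10 | s2 => 11 | t1 => 12
  | t2 => 13 | t3 => 14 | x_s1 => 15 | y_s1 => 16 | z_s1 => 17
  | x_s2 => 18 | y_s2 => 19 | z_s2 => 20 | x_t3 => 21 | y_t3 => 22
  | z_t3 => 23
  end.

Definition Gstar_decode (i : nat) : Gstar_vertex :=
  nth (Pet P12) Gstar_vertices i.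

Lemma Gstar_codeK : cancel Gstar_code Gstar_decode.
Proof. by repeat case. Qed.

HB.instance Definition _ := Countable.copy Gstar_vertex (can_type Gstar_codeK).

Lemma Gstar_enumP : Finite.axiom Gstar_vertices.
Proof. by repeat case. Qed.

HB.instance Definition _ := isFinite.Build Gstar_vertex Gstar_enumP.

Definition Gstar_edges : seq (Gstar_vertex * Gstar_vertex) :=
  let u := Pet P12 in
  let h1 := Pet P34 in let h2 := Pet P35 in let h3 := Pet P45 in
  [seq (Pet e.1, Pet e.2) | e <- petersen_edges & P12 \notin [:: e.1; e.2]] ++
  [:: (u, s1); (s1, h1); (u, s2); (s2, h2);
      (u, t1); (t1, t2); (t2, t3); (t1, t3); (t2, h3)] ++
  S4_edges x_s1 y_s1 z_s1 s1 ++
  S4_edges x_s2 y_s2 z_s2 s2 ++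
  S4_edges x_t3 y_t3 z_t3 t3.

Lemma Gstar_loopless : loopless Gstar_edges.
Proof. by []. Qed.

Definition Gstar : mgraph := mgraph_of_list Gstar_loopless.

Lemma card_Gstar : #|vert Gstar| = 24.
Proof. by rewrite cardT enumT unlock. Qed.

Lemma Gstar_cubic : cubic Gstar.
Proof. by move=> v; rewrite card_incident_list; move: v; repeat case. Qed.

(* Main.v *)
From mathcomp Require Import all_boot.
Require Import Defs.

(** In each block i of S10 write a_i, b_i for the parallel edges, p_i and q_i
    for the two edges joining them to z_i, and c_i for the bridge z_i w.  The
    stars of S10 are {c_1, c_2, c_3} and, for each i, {c_i, p_i, q_i},
    {a_i, b_i, p_i} and {a_i, b_i, q_i}.  A coloring makes the star of every
    vertex of G* one of these.

    The part of G* added to the Petersen graph P acts on P only through the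
    pairs of colors that it lets through.  A copy of S4 forces a bridge color
    on its pendant edge ([pendant_forced]).  Hence the two halves of a
    subdivided edge at u are two distinct bridges or p_i and q_i in some order
    ([subdivided_forced]); the edge carrying the triangle also allows both
    halves to be the same a_i or b_i ([expanded_forced]).

    What remains is a coloring problem on P in which the three edges at u have
    two halves each, and it has no solution ([petersen_unsolvable]).  The
    reason is as follows.  The third edge at u cannot be colored a_i or b_i at
    u, because another edge at u would be the other one of these; so on all
    three edges at u the halves are distinct bridges or {p_i, q_i}.  The edges
    colored a_i or b_i form circuits of P that avoid u, on which a_i and b_i
    alternate, so these circuits are even.  If there are none, the edges
    colored p_i or q_i form circuits on which p_i and q_i alternate, and they
    are even in P too: each edge at u that they use has both colors on its
    halves, and a circuit uses none or two such edges.  An even circuit of P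
    has length 6 or 8, so at most one fits.
    - If there is no circuit of either kind, only bridges occur.  By parity on
      the nine vertices other than u, the halves away from u have three
      distinct colors, and P would be 3-edge-colorable, which it is not.
    - Otherwise let C be the circuit and i the index of its block.  The
      vertices off C induce an edge if C has length 8, and a claw if it has
      length 6, so each of the two ends of the edge, or of the three leaves of
      the claw, has two edges to C.
      If C is colored p_i, q_i, an edge that leaves C and is not at u is colored
      c_i; among the ends, or the leaves, there is one,
      other than u, whose two edges to C do not meet u, and it sees c_i twice.
      If C is colored a_i, b_i, an edge that leaves C is colored p_i or q_i
      at its end on C.  If C has length 8, then u is off C, and both u and the other
      vertex off C see p_i and q_i, so that both halves of the edge joining
      them are c_i, although they must differ.  If C has length 6 and u is the
      center of the claw, then the three leaves see c_i on the halves of the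
      edges to u, which leaves only the two other bridges for the three
      halves at u.  If u is a leaf, the center sees c_i on its edges to the two
      other leaves.

    The local statements and the one on P are finite constraint problems.
    They are settled by a complete backtracking search ([solutions],
    [entails_sound]), which is small because it runs on one gadget at a time
    and then on P alone. *)

Set Implicit Arguments.
Unset Strict Implicit.
Unset Printing Implicit Defensive.

Definition star (V : eqType) (s : seq (V * V)) (v : V) : seq nat :=
  [seq i <- iota 0 (size s) |
    (v == (nth (v, v) s i).1) || (v == (nth (v, v) s i).2)].

Lemma star_incident (V : finType) (s : seq (V * V)) (s_ok : loopless s)
    (v : V) :
  star s v = [seq val i | i <- enum (@incident_edges (mgraph_of_list s_ok) v)].
Proof.
rewrite /star -val_enum_ord filter_map {2}/enum_mem -enumT; congr map.
apply: (@eq_filter 'I_(size s)) => i.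
by rewrite /= [RHS]in_set /= in_setU !in_set1 (tnth_nth (v, v)).
Qed.

Definition star_orders (W : eqType) (s : seq (W * W)) (ws : seq W) :
    seq (seq nat) :=
  flatten [seq permutations (star s w) | w <- ws].

(** Passage from colorings to constraints on numbers: properness makes a
    coloring injective on each star, so an equality of sets of colors becomes a
    reordering of a star of the target, with no repetition to account for. *)
Lemma coloring_stars (V W : finType) (s : seq (V * V)) (t : seq (W * W))
    (s_ok : loopless s) (t_ok : loopless t) (ws : seq W) :
  (forall w, w \in ws) ->
  colors (mgraph_of_list t_ok) (mgraph_of_list s_ok) ->
  exists g : nat -> nat, forall v, map g (star s v) \in star_orders t ws.
Proof.
move=> ws_full [f [f_proper f_star]].
exists (fun n => if insub n is Some i then val (f i) else 0) => v.
have [u f_vu] := f_star v.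
apply/flatten_mapP; exists u => //; rewrite mem_permutations.
rewrite !star_incident -map_comp.
under eq_map => i do rewrite /= valK.
rewrite (map_comp val f); apply: perm_map; apply: uniq_perm.
- rewrite map_inj_in_uniq ?enum_uniq // => i j; rewrite !mem_enum.
  rewrite ![_ \in incident_edges _]in_set => i_v j_v f_ij.
  apply/eqP/negPn/negP => i_neq_j; apply: (f_proper i j) f_ij.
  by rewrite /adjacent i_neq_j; apply/existsP; exists v; rewrite i_v.
- exact: enum_uniq.
- move=> c; rewrite mem_enum -f_vu; apply/mapP/imsetP => -[i].
    by rewrite mem_enum => ? ->; exists i.
  by move=> ? ->; exists i; rewrite ?mem_enum.
Qed.

(** Variables, here the edges of G*, together with the tuples of values that they
    may take. *)
Definition constraint := (seq nat * seq (seq nat))%type.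

Definition satisfies (g : nat -> nat) (c : constraint) : bool :=
  map g c.1 \in c.2.

Fixpoint lookup (p : seq (nat * nat)) (k : nat) : option nat :=
  if p is kv :: p' then if k == kv.1 then Some kv.2 else lookup p' k else None.

(** Nested conditionals in place of [&&], which a strict evaluator computes
    on both sides even when the first value already disagrees. *)
Fixpoint fits (pat : seq (option nat)) (t : seq nat) : bool :=
  match pat, t with
  | Some w :: pat', v :: t' => if w == v then fits pat' t' else false
  | None :: pat', _ :: t' => fits pat' t'
  | _, _ => true
  end.

Fixpoint solutions (cs : seq constraint) (p : seq (nat * nat)) :
    seq (seq (nat * nat)) :=
  if cs is c :: cs' then
    flatten [seq solutions cs' (zip c.1 t ++ p) |
              t <- c.2 & fits (map (lookup p) c.1) t]
  else [:: p].

(** The variables of [c] that no constraint of [cs] mentions are looked up as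
    [None] and make the test fail on every solution.  With [c = ([::], [::])] the test says that
    [cs] has no solution at all, since the list of allowed tuples is empty. *)
Definition entails (cs : seq constraint) (c : constraint) : bool :=
  all (fun p => map (lookup p) c.1 \in map (map Some) c.2) (solutions cs [::]).

Section Soundness.

Variable g : nat -> nat.

Definition agrees (p : seq (nat * nat)) : bool :=
  all (fun kv => g kv.1 == kv.2) p.

Lemma lookup_agrees p k v : agrees p -> lookup p k = Some v -> v = g k.
Proof.
elim: p => //= kv p IHp /andP[/eqP <- /IHp{}IHp].
by case: eqP => [-> [<-] | _].
Qed.

(** Among the branches of the search there is always the one that follows the
    values of [g]. *)
Lemma solutions_complete cs p :
  agrees p -> all (satisfies g) cs ->
  exists2 q, q \in solutions cs p & agrees q.
Proof.
elim: cs p => [|[xs ts] cs IHcs] p p_ok /=; first by exists p; rewrite ?inE.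
case/andP=> xs_ok /IHcs{}IHcs.
have [|q q_sol q_ok] := IHcs (zip xs (map g xs) ++ p).
  rewrite /agrees all_cat [X in _ && X]p_ok andbT.
  by elim: xs {xs_ok} => //= x xs ->; rewrite eqxx.
exists q => //; apply/flatten_mapP; exists (map g xs) => //.
rewrite mem_filter [X in _ && X]xs_ok andbT; elim: xs {xs_ok q_sol} => //= x xs IHxs.
by case E: (lookup p x) => [w|//]; rewrite (lookup_agrees p_ok E) eqxx.
Qed.

(** Turns a computation into a fact about every assignment; a gadget of G* can
    thus be replaced by the constraint that it imposes on its outer edges. *)
Lemma entails_sound cs c : entails cs c -> all (satisfies g) cs -> satisfies g c.
Proof.
move=> /allP c_forced /(@solutions_complete _ [::] isT)[q /c_forced].
case/mapP=> t t_in xs_t q_ok; rewrite /satisfies.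
suff -> : map g c.1 = t by [].
elim: c.1 t {t_in} xs_t => [|x xs IHxs] [|v t] //= [/(lookup_agrees q_ok) ->].
by move=> /IHxs ->.
Qed.

End Soundness.

Definition color_orders : seq (seq nat) := star_orders S10_edges S10_vertices.

Definition bridges : seq nat :=
  [seq index (z, S10_w) S10_edges | z <- [:: S10_z1; S10_z2; S10_z3]].

Definition parallel_colors : seq nat :=
  [seq i <- iota 0 (size S10_edges) |
    count_mem (nth (S10_w, S10_w) S10_edges i) S10_edges == 2].

(** The ordered pairs of colors that, with a bridge, fill a star of S10: two
    distinct bridges, or the two other edges at some z_i. *)
Definition through_bridge : seq (seq nat) :=
  [seq behead t | t <- color_orders & head 0 t \in bridges].

Definition through_triangle : seq (seq nat) :=
  through_bridge ++ [seq [:: d; d] | d <- parallel_colors].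

Definition at_vertex (v : Gstar_vertex) : constraint :=
  (star Gstar_edges v, color_orders).

Definition edge_no (v w : Gstar_vertex) : nat := index (v, w) Gstar_edges.

Definition at_bridge (z q : Gstar_vertex) : constraint :=
  ([:: edge_no z q], [seq [:: c] | c <- bridges]).

Definition at_subdivided (h s : Gstar_vertex) : constraint :=
  ([:: edge_no (Pet P12) s; edge_no s h], through_bridge).

Definition at_expanded : constraint :=
  ([:: edge_no (Pet P12) t1; edge_no t2 (Pet P45)], through_triangle).

(** The stars at x and y share two colors.  Two colors lie in at most one star
    of S10, unless they are a_i and b_i; in all other cases x z and y z would
    have the same color, which is impossible at z.  So x z and y z have the
    colors p_i and q_i, and only c_i completes a star with them. *)
Lemma pendant_forced :
  [&& entails [seq at_vertex v | v <- [:: x_s1; y_s1; z_s1]] (at_bridge z_s1 s1),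
      entails [seq at_vertex v | v <- [:: x_s2; y_s2; z_s2]] (at_bridge z_s2 s2)
    & entails [seq at_vertex v | v <- [:: x_t3; y_t3; z_t3]] (at_bridge z_t3 t3)].
Proof. by vm_compute. Qed.

Lemma subdivided_forced :
  entails [:: at_bridge z_s1 s1; at_vertex s1] (at_subdivided (Pet P34) s1) &&
  entails [:: at_bridge z_s2 s2; at_vertex s2] (at_subdivided (Pet P35) s2).
Proof. by vm_compute. Qed.

(** The bridge at t3 and the two edges from t3 fill a star.  If these edges are
    c_i and c_j, the triangle is colored by the three bridges and the outer
    edges are c_j and c_i.  If they are p_i and q_i, the edge t1 t2 is c_i, with
    outer edges q_i and p_i, or one of the parallel edges a_i, b_i, with the
    other one on both outer edges. *)
Lemma expanded_forced :
  entails [:: at_bridge z_t3 t3; at_vertex t3; at_vertex t1; at_vertex t2]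
    at_expanded.
Proof. by vm_compute. Qed.

(** The vertices are ordered so that most of them come when one or more of
    their edges already have colors, which keeps the search narrow. *)
Definition petersen_constraints : seq constraint :=
  [:: at_subdivided (Pet P34) s1; at_subdivided (Pet P35) s2; at_expanded] ++
  [seq at_vertex v | v <- map Pet
    [:: P12; P34; P15; P35; P24; P14; P45; P23; P13; P25]].

(** This is where the structure of P enters: it has girth 5, no Hamiltonian
    circuit and no 3-edge-coloring. *)
Lemma petersen_unsolvable : entails petersen_constraints ([::], [::]).
Proof. vm_cast_no_check (erefl true). Qed.

Theorem theorem3p1 : ~ colors S10 Gstar.
Proof.
case/(coloring_stars (ws := S10_vertices)) => [|g g_ok]; first by repeat case.
have at_vertices vs : all (satisfies g) [seq at_vertex v | v <- vs].
  by rewrite all_map; apply/allP => v _; apply: g_ok.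
have [p1 p2 p3] := and3P pendant_forced.
have {p1}b1 := entails_sound p1 (at_vertices _).
have {p2}b2 := entails_sound p2 (at_vertices _).
have {p3}b3 := entails_sound p3 (at_vertices _).
have [l1 l2] := andP subdivided_forced.
have {l1 b1}s1_ok :=
  entails_sound l1 (introT andP (conj b1 (at_vertices [:: _]))).
have {l2 b2}s2_ok :=
  entails_sound l2 (introT andP (conj b2 (at_vertices [:: _]))).
have {b3}t_ok := entails_sound expanded_forced
  (introT andP (conj b3 (at_vertices [:: _; _; _]))).
suff: satisfies g ([::], [::]) by [].
apply: (entails_sound petersen_unsolvable).
rewrite /petersen_constraints all_cat at_vertices andbT.
exact/and4P.
Qed.
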